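(* Define polynomials $q_k(x)$ ($k\ge -1$) by $q_{-1}(x)=1$ and $q_{k+1}(x)=(2(k+1)x+1)q_k(x)+2x(1-x)q_k'(x)$, and for $a\in\mathbb{R}$ define polynomials $p_k(a,x)$ ($k\ge-1$) by $p_{-1}(a,x)=0$ and \[ p_{k+1}(a,x)=2\big((k+1-a)x+a\big)p_k(a,x)+2x(1-x)p_k'(a,x)+q_k(x), \] where $'$ denotes differentiation with respect to $x$. Then for every $k\in\mathbb{Z}_{\ge0}$, every $a\in\mathbb{R}\setminus\frac12\mathbb{Z}_{\le0}$ and every $|z|<1$, \[ 2^{k-1}\Phi_{HCB}(1-k,a,z)=\frac{4^a z^{2a}}{2a\binom{2a}{a}(1-z^2)^{k+\frac12}}\left((2a-1)\sqrt{1-z^2}\,p_{k-1}(a,z^2)+{}_2F_1\!\left(\begin{matrix}\frac12,\,a-\frac12\\ a+\frac12\end{matrix};z^2\right)q_{k-1}(z^2)\right). \]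
   Context: For $|z|<1$ and real $a$ not a non-positive half-integer, $\Phi_{HCB}(s,a,z):=\sum_{n=0}^{\infty}\frac{(2z)^{2(n+a)}}{\binom{2(n+a)}{n+a}(n+a)^s}$, with $\binom{x}{y}:=\frac{\Gamma(x+1)}{\Gamma(y+1)\Gamma(x-y+1)}$ for real $x,y$. ${}_2F_1\!\left(\begin{matrix}\alpha,\beta\\ \gamma\end{matrix};z\right)=\sum_{n\ge0}\frac{(\alpha)_n(\beta)_n}{(\gamma)_n n!}z^n$ with $(\alpha)_n=\Gamma(\alpha+n)/\Gamma(\alpha)$. *)

(* Defs.v *)
From HB Require Import structures.
From mathcomp Require Import all_boot all_order all_algebra complex.
From mathcomp Require Import all_classical all_reals all_analysis.
From mathcomp Require Import ring lra.

Set Implicit Arguments.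
Unset Strict Implicit.
Unset Printing Implicit Defensive.

Import Order.TTheory GRing.Theory Num.Theory.
Import numFieldNormedType.Exports.

Local Open Scope classical_set_scope.
Local Open Scope ring_scope.
Local Open Scope complex_scope.

(* The usual topology of the complex numbers (the one of the modulus). *)
HB.instance Definition _ (R : realType) := NormedModule.copy R[i] R[i]^o.

Definition cexp (R : realType) (w : R[i]) : R[i] :=
  (expR (complex.Re w))%:C * (cos (complex.Im w) +i* sin (complex.Im w)).

(* The principal argument, in ]-pi, pi], for z != 0. *)
Definition carg (R : realType) (z : R[i]) : R :=
  let t := acos (complex.Re z / Normc.normc z) in
  if 0 <= complex.Im z then t else - t.

Definition clog (R : realType) (z : R[i]) : R[i] :=
  ln (Normc.normc z) +i* carg z.

(* Principal branch of z^w, with 0^0 = 1 and 0^w = 0 for w != 0. *)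
Definition cpow (R : realType) (z w : R[i]) : R[i] :=
  if z == 0 then (w == 0)%:R else cexp (w * clog z).

Definition gauss_seq (R : realType) (x : R) (n : nat) : R :=
  n`!%:R * n%:R `^ x / \prod_(i < n.+1) (x + i%:R).

(* The Gamma function as the Euler-Gauss limit n! n^x / (x (x+1) ... (x+n)),
   which covers every real x that is not a pole 0, -1, -2, ...; at a pole the
   value is meaningless. *)
Definition Gamma (R : realType) (x : R) : R := limn (gauss_seq x).

Definition rbinom (R : realType) (x y : R) : R :=
  Gamma (x + 1) / (Gamma (y + 1) * Gamma (x - y + 1)).

(* The product form of (x)_n = Gamma (x + n) / Gamma x; unlike the quotient, it
   is also meaningful when x is a pole of Gamma, e.g. (0)_n = (n == 0). *)
Definition poch (K : comNzRingType) (x : K) (n : nat) : K :=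
  \prod_(i < n) (x + i%:R).

Definition hyp2F1 (R : realType) (al be ga z : R[i]) : R[i] :=
  limn (series (fun n : nat =>
    poch al n * poch be n / (poch ga n * n`!%:R) * z ^+ n)).

Definition PhiHCB (R : realType) (s : R[i]) (a : R) (z : R[i]) : R[i] :=
  limn (series (fun n : nat =>
    cpow (2 * z) (2 * (n%:R + a%:C)) /
    ((rbinom (2 * (n%:R + a)) (n%:R + a))%:C * cpow (n%:R + a%:C) s))).

(* The indices are shifted by one: HCBq j is q_{j-1} and HCBp a j is
   p_{j-1}(a, .), so that the index k of the recurrences is j - 1. *)
Fixpoint HCBq (R : realType) (j : nat) : {poly R} :=
  if j is j'.+1 then
    ((2 * j'%:R) *: 'X + 1) * HCBq R j'
    + 2 *: ('X * (1 - 'X) * (HCBq R j')^`())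
  else 1.
Arguments HCBq R j : clear implicits.

Fixpoint HCBp (R : realType) (a : R) (j : nat) : {poly R} :=
  if j is j'.+1 then
    2 *: (((j'%:R - a) *: 'X + a%:P) * HCBp a j')
    + 2 *: ('X * (1 - 'X) * (HCBp a j')^`()) + HCBq R j'
  else 0.

Definition ceval (R : realType) (p : {poly R}) (z : R[i]) : R[i] :=
  (map_poly (real_complex R) p).[z].

(* Checks on Gamma: no zero, Gamma 1 = 1, the functional equation, and the
   agreement of poch with the quotient of Gamma values off the poles. *)
Section GammaFacts.
Variable R : realType.
Implicit Types (x t : R) (n : nat).

Lemma powR_bernoulli x t : 0 <= x <= 1 -> 0 < t -> t `^ x <= 1 + x * (t - 1).
Proof.
move=> /andP[x0 x1] t0.
have x01 : x \in `[0, 1] by rewrite in_itv /= x0 x1.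
have e0 : 0 < 1 + x * (t - 1) by nra.
have x01' : Itv.spec (Itv.num_sem (R := R)) (Itv.Real `[0%Z, 1%Z]) x.
  by rewrite /= /Itv.num_sem/= !in_itv/= x0 x1 realE x0.
pose p : {i01 R} := Itv.Def x01'.
have := concave_ln p t0 ltr01; rewrite !convRE /= ln1 mulr0 addr0 /unstable.onem mulr1.
have -> : x * t + (1 - x) = 1 + x * (t - 1) by ring.
by move=> le; rewrite /powR gt_eqF// -(lnK e0) ler_expR.
Qed.

Lemma powRS_le x n : 0 <= x <= 1 -> (0 < n)%N ->
  n.+1%:R `^ x * n%:R <= n%:R `^ x * (n%:R + x) :> R.
Proof.
move=> x01 n0; have n0' : 0 < n%:R :> R by rewrite ltr0n.
have -> : n.+1%:R = n%:R * (1 + n%:R^-1) :> R.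
  by rewrite mulrDr mulr1 mulfV ?gt_eqF// natr1.
rewrite powRM ?addr_ge0 ?invr_ge0 ?ler0n// -mulrA ler_wpM2l ?powR_ge0//.
have t0 : 0 < 1 + n%:R^-1 :> R by rewrite addr_gt0 ?invr_gt0.
rewrite -ler_pdivlMr//; apply: le_trans (powR_bernoulli x01 t0) _.
by rewrite le_eqVlt; apply/orP; left; apply/eqP; field; rewrite gt_eqF.
Qed.

Lemma powRS_ge x n : 0 <= x <= 1 -> (0 < n)%N ->
  n%:R `^ x * n.+1%:R <= n.+1%:R `^ x * (n.+1%:R - x) :> R.
Proof.
move=> x01 n0; have n0' : 0 < n%:R :> R by rewrite ltr0n.
have n1 : 0 < n.+1%:R :> R by rewrite ltr0n.
have en : n%:R = n.+1%:R * (n%:R / n.+1%:R) :> R by rewrite mulrC divfK ?gt_eqF.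
rewrite {1}en powRM ?divr_ge0 ?ler0n// -mulrA ler_wpM2l ?powR_ge0//.
have t0 : 0 < n%:R / n.+1%:R :> R by rewrite divr_gt0.
rewrite -ler_pdivlMr//; apply: le_trans (powR_bernoulli x01 t0) _.
rewrite le_eqVlt; apply/orP; left; apply/eqP.
rewrite -natr1; field; by rewrite natr1 gt_eqF.
Qed.

Lemma gauss_prod_gt0 x n : 0 < x -> 0 < \prod_(i < n) (x + i%:R).
Proof. by move=> x0; apply: prodr_gt0 => i _; rewrite ltr_pwDl. Qed.

Lemma gauss_cvg01 x : 0 < x <= 1 -> exists2 l : R, l != 0 & gauss_seq x @ \oo --> l.
Proof.
move=> /andP[x0 x1]; have x01 : 0 <= x <= 1 by rewrite ltW.
pose v n := gauss_seq x n.+1.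
have fS n : 0 < n`!%:R :> R by rewrite ltr0n fact_gt0.
have vS n : v n <= v n.+1.
  rewrite /v /gauss_seq [in leRHS]big_ord_recr /= (factS n.+1) natrM.
  have := gauss_prod_gt0 n.+2 x0; set P := \prod_(_ < _) _ => P0.
  have := @powRS_ge x n.+1 x01 isT; have := powR_gt0 x (ltr0n R n.+2).
  have := powR_ge0 (n.+1%:R : R) x.
  set A := _ `^ _; set B := _ `^ _; have := fS n.+1; set f := _%:R.
  have := ltr0Sn R n.+1; set N := n.+2%:R => N0 f0 A0 B0 AB.
  have d0 : 0 < P * (x + N) by rewrite mulr_gt0 ?addr_gt0.
  rewrite ler_pdivrMr// [leRHS]mulrAC ler_pdivlMr//.
  suff : A * (x + N) <= N * B.
    move=> h; rewrite [leLHS](_ : _ = f * P * (A * (x + N))); last by ring.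
    by rewrite [leRHS](_ : _ = f * P * (N * B)) ?ler_pM2l ?mulr_gt0//; ring.
  rewrite -(ler_pM2r N0).
  have : A * N * (x + N) <= B * (N - x) * (x + N) by rewrite ler_wpM2r// addr_ge0// ltW.
  have : 0 <= B * x ^+ 2 by rewrite mulr_ge0 ?sqr_ge0 ?ltW.
  rewrite !expr2; nra.
have dS n : v n * (1 + x / n.+1%:R) <= x^-1.
  elim: n => [|n IH].
    rewrite /v /gauss_seq !big_ord_recr big_ord0/= powR1 addr0 divr1 !mul1r.
    have x1' : 1 + x != 0 by rewrite gt_eqF// addr_gt0.
    rewrite le_eqVlt; apply/orP; left; apply/eqP; field.
    by rewrite addrC x1' gt_eqF.
  apply: le_trans IH; rewrite /v /gauss_seq [in leLHS]big_ord_recr /= (factS n.+1) natrM.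
  have := gauss_prod_gt0 n.+2 x0; set P := \prod_(_ < _) _ => P0.
  have := @powRS_le x n.+1 x01 isT; have := powR_gt0 x (ltr0n R n.+2).
  have := powR_ge0 (n.+1%:R : R) x.
  set A := _ `^ _; set B := _ `^ _; have := fS n.+1; set f := _%:R.
  have := ltr0Sn R n; set M := n.+1%:R.
  have := ltr0Sn R n.+1; set N := n.+2%:R => N0 M0 f0 A0 B0 AB.
  have d0 : 0 < x + N by rewrite addr_gt0.
  clearbody M N.
  rewrite [leLHS](_ : _ = f / P / M * (B * M)); last by field; rewrite (gt_eqF P0) (gt_eqF M0) (gt_eqF N0) (gt_eqF d0).
  rewrite [leRHS](_ : _ = f / P / M * (A * (M + x))); last by field; rewrite (gt_eqF P0) (gt_eqF M0).
  by rewrite ler_pM2l// ?divr_gt0.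
have vnd : nondecreasing_seq v by apply/nondecreasing_seqP.
have v0 : 0 < v 0.
  by rewrite /v /gauss_seq divr_gt0 ?gauss_prod_gt0// mulr_gt0// powR_gt0.
have vc : cvgn v.
  apply: nondecreasing_is_cvgn => //; exists x^-1 => _ [n _ <-].
  apply: le_trans (dS n); rewrite ler_peMr//.
    by rewrite (le_trans (ltW v0))// vnd.
  by rewrite lerDl divr_ge0 ?ler0n ?ltW.
exists (limn v); last by rewrite -cvg_shiftS.
by rewrite gt_eqF// (lt_le_trans v0)// nondecreasing_cvgn_le.
Qed.

Lemma gauss_seqD1 x n : x != 0 -> (0 < n)%N -> x + n.+1%:R != 0 ->
  gauss_seq (x + 1) n = gauss_seq x n * (x * (n%:R / (x + n.+1%:R))).
Proof.
move=> x0 n0 xn; rewrite /gauss_seq powRD ?pnatr_eq0 -?lt0n ?n0 ?implybT//.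
rewrite powRr1// big_ord_recr [in RHS]big_ord_recl /= addr0 -addrA nat1r.
under eq_bigr do rewrite -addrA nat1r.
set P := \prod_(_ < _) _; rewrite !invfM; move: (P^-1) => Q.
by field; rewrite nat1r xn x0.
Qed.

Lemma gauss_cvgD1 x : (forall m : nat, x != - m%:R) ->
  (fun n => n%:R / (x + n.+1%:R) : R) @ \oo --> (1 : R).
Proof.
move=> hx.
have h1 : (fun n => (n.+1%:R)^-1 : R) @ \oo --> (0 : R) by exact: cvg_harmonic.
have h2 : (fun n => (1 - n.+1%:R^-1) / (1 + x / n.+1%:R) : R) @ \oo
    --> ((1 - 0) / (1 + x * 0) : R).
  apply: cvgM; first by apply: cvgB => //; exact: cvg_cst.
  apply: cvgV; first by rewrite mulr0 addr0 oner_neq0.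
  apply: cvgD; first exact: cvg_cst.
  by apply: cvgM => //; exact: cvg_cst.
move: h2; rewrite subr0 mulr0 addr0 divr1; apply: cvg_trans.
apply: near_eq_cvg; near=> n.
have n0 : n.+1%:R != 0 :> R by rewrite pnatr_eq0.
have xn : x + n.+1%:R != 0 by rewrite addr_eq0 hx.
have xn' : n.+1%:R + x != 0 by rewrite addrC.
by field; rewrite ?nat1r ?natr1 ?xn ?xn' ?n0.
Unshelve. all: by end_near. Qed.

Lemma gauss_cvgS x (l : R) : (forall m : nat, x != - m%:R) ->
  gauss_seq x @ \oo --> l -> gauss_seq (x + 1) @ \oo --> x * l.
Proof.
move=> hx hl; have x0 : x != 0 by have := hx 0%N; rewrite oppr0.
have : (fun n => gauss_seq x n * (x * (n%:R / (x + n.+1%:R)))) @ \oo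
    --> l * (x * 1).
  by apply: cvgM => //; apply: cvgM; [exact: cvg_cst|exact: gauss_cvgD1].
rewrite mulr1 [l * x]mulrC; apply: cvg_trans; apply: near_eq_cvg; near=> n.
rewrite gauss_seqD1//; last by rewrite addr_eq0.
by near: n; exists 1%N.
Unshelve. all: by end_near. Qed.

Lemma gauss_cvgP x (l : R) : (forall m : nat, x != - m%:R) ->
  gauss_seq (x + 1) @ \oo --> l -> gauss_seq x @ \oo --> l / x.
Proof.
move=> hx hl; have x0 : x != 0 by have := hx 0%N; rewrite oppr0.
have : (fun n => gauss_seq (x + 1) n / (x * (n%:R / (x + n.+1%:R)))) @ \oo
    --> l / (x * 1).
  apply: cvgM => //; apply: cvgV; first by rewrite mulr1.
  by apply: cvgM; [exact: cvg_cst|exact: gauss_cvgD1].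
rewrite mulr1; apply: cvg_trans; apply: near_eq_cvg; near=> n.
have n0 : (0 < n)%N by near: n; exists 1%N.
have xn : x + n.+1%:R != 0 by rewrite addr_eq0.
rewrite gauss_seqD1// mulfK// !mulf_neq0// ?invr_eq0// pnatr_eq0 -lt0n//.
Unshelve. all: by end_near. Qed.

Lemma gauss_cvg x : (forall m : nat, x != - m%:R) ->
  exists2 l : R, l != 0 & gauss_seq x @ \oo --> l.
Proof.
have pos n : forall x, 0 < x <= n.+1%:R ->
    exists2 l : R, l != 0 & gauss_seq x @ \oo --> l.
  elim: n => [|n IH] {}x; first exact: gauss_cvg01.
  move=> /andP[x0 xn]; have [x1|x1] := leP x 1.
    by apply: gauss_cvg01; rewrite x0.
  have [|l l0 hl] := IH (x - 1).
    by rewrite subr_gt0 x1 lerBlDr natr1.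
  exists ((x - 1) * l); first by rewrite mulf_neq0// subr_eq0 gt_eqF.
  rewrite -{1}(subrK 1 x); apply: gauss_cvgS => // m.
  by rewrite gt_eqF// (@le_lt_trans _ _ 0) ?oppr_le0 ?subr_gt0.
have neg n : forall x, (forall m : nat, x != - m%:R) -> - n%:R < x ->
    exists2 l : R, l != 0 & gauss_seq x @ \oo --> l.
  elim: n => [|n IH] {}x hx xn.
    apply: (pos (Num.truncn x)); rewrite oppr0 in xn; rewrite xn ltW//.
    by rewrite truncnS_gt.
  have [||l l0 hl] := IH (x + 1).
  - by move=> m; have := hx m.+1; rewrite -natr1 opprD -subr_eq opprK.
  - by move: xn; rewrite -natr1 opprD ltrBlDr.
  exists (l / x); last exact: gauss_cvgP.
  by rewrite mulf_neq0// invr_eq0; have := hx 0%N; rewrite oppr0.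
move=> hx; apply: (neg (Num.truncn `|x|).+1) => //.
rewrite ltrNl (le_lt_trans (ler_norm _))// normrN truncnS_gt//.
Qed.

Lemma Gamma_neq0 x : (forall m : nat, x != - m%:R) -> Gamma x != 0.
Proof. by move=> /gauss_cvg[l l0 hl]; rewrite /Gamma (cvg_lim _ hl). Qed.

Lemma GammaD1 x : (forall m : nat, x != - m%:R) ->
  Gamma (x + 1) = x * Gamma x.
Proof.
move=> hx; have [l l0 hl] := gauss_cvg hx.
by rewrite /Gamma (cvg_lim _ hl)// (cvg_lim _ (gauss_cvgS hx hl)).
Qed.

Lemma Gamma1 : Gamma (1 : R) = 1.
Proof.
rewrite /Gamma; apply: cvg_lim => //.
have h1 : (fun n => (n.+1%:R)^-1 : R) @ \oo --> (0 : R) by exact: cvg_harmonic.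
have : (fun n => 1 - n.+1%:R^-1 : R) @ \oo --> (1 - 0 : R).
  by apply: cvgB => //; exact: cvg_cst.
rewrite subr0; apply: cvg_trans; apply: near_eq_cvg; near=> n.
have e m : \prod_(i < m) (1 + i%:R) = m`!%:R :> R.
  by elim: m => [|m IH]; rewrite ?big_ord0// big_ord_recr/= IH factS natrM nat1r mulrC.
rewrite /gauss_seq e factS natrM powRr1// invfM.
have f0 : n`!%:R != 0 :> R by rewrite pnatr_eq0 -lt0n fact_gt0.
have n0 : n.+1%:R != 0 :> R by rewrite pnatr_eq0.
by field; rewrite ?nat1r ?natr1 ?f0 ?n0.
Unshelve. all: by end_near. Qed.

Lemma poch_Gamma x n : (forall m : nat, x != - m%:R) ->
  poch x n = Gamma (x + n%:R) / Gamma x.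
Proof.
move=> hx; elim: n => [|n IH].
  by rewrite /poch big_ord0 addr0 divff// Gamma_neq0.
rewrite /poch big_ord_recr /= -/(poch x n) IH -natr1 addrA GammaD1; last first.
  by move=> m; have := hx (m + n)%N; rewrite natrD opprD -subr_eq opprK.
by ring.
Qed.
End GammaFacts.

(* Main.v *)
(* Put u_n = (a)_n / (a+1/2)_n, F(x) = sum_n u_n x^n and x = z^2. The functional
   equation of Gamma turns the n-th term of Phi_HCB(1-k, a, z) into a constant
   times (2(n+a))^k u_n x^n, that is theta^k F with theta = 2 x d/dx + 2 a. The
   recurrence of u_n reads (1-x) theta F = F + 2a - 1, and iterating it gives
   (1-x)^k theta^k F = (2a-1) p_{k-1}(a, x) + q_{k-1}(x) F. This is carried out
   on the truncations of F, as an identity of polynomials whose remainder is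
   u_N x^N times a polynomial in N and x.
   It remains to see that F = (1-x)^(-1/2) 2F1(1/2, a-1/2; a+1/2; x). Let A be the
   binomial series of (1-x)^(1/2). The coefficients of A F satisfy a first-order
   recurrence that identifies A F with the 2F1; for a = 1/2 the 2F1 is 1 and F is
   the binomial series of (1-x)^(-1/2), which yields A^2 = 1 - x. Finally
   |A - 1| <= |x| < 1, so Re A > 0 and A is the principal square root. *)

Require Import Defs.
From mathcomp Require Import all_boot all_order all_algebra complex.
From mathcomp Require Import all_classical all_reals all_analysis.
From mathcomp Require Import ring lra.

Set Implicit Arguments.
Unset Strict Implicit.
Unset Printing Implicit Defensive.

Import Order.TTheory GRing.Theory Num.Theory.
Import numFieldNormedType.Exports.

Local Open Scope ring_scope.
Local Open Scope complex_scope.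

(** * Limits and power series with bounded coefficients over [R[i]] *)

Section ComplexLimits.
Local Open Scope classical_set_scope.
Variable R : realType.
Implicit Types (f : nat -> R[i]) (g : nat -> R) (x : R[i]).

(* [cvgD], [cvgB] and [cvgM] at the type R[i]: with the structures of R[i] left
   to unification, applying the generic lemmas diverges. *)
Lemma cvgcD f1 f2 (l1 l2 : R[i]) : f1 @ \oo --> l1 -> f2 @ \oo --> l2 ->
  (fun n => f1 n + f2 n) @ \oo --> l1 + l2.
Proof. by move=> h1 h2; exact: (@cvgD R[i] R[i] nat _ _ f1 f2 l1 l2 h1 h2). Qed.

Lemma cvgcB f1 f2 (l1 l2 : R[i]) : f1 @ \oo --> l1 -> f2 @ \oo --> l2 ->
  (fun n => f1 n - f2 n) @ \oo --> l1 - l2.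
Proof. by move=> h1 h2; exact: (@cvgB R[i] R[i] nat _ _ f1 f2 l1 l2 h1 h2). Qed.

Lemma cvgcM f1 f2 (l1 l2 : R[i]) : f1 @ \oo --> l1 -> f2 @ \oo --> l2 ->
  (fun n => f1 n * f2 n) @ \oo --> l1 * l2.
Proof. by move=> h1 h2; exact: (@cvgM R[i] nat _ _ f1 f2 l1 l2 h1 h2). Qed.

Lemma eq_cvgc f1 f2 (l : R[i]) : f1 =1 f2 -> f1 @ \oo --> l -> f2 @ \oo --> l.
Proof. by move=> /funext ->. Qed.

Lemma cvg_real_complex g (l : R) :
  g @ \oo --> l -> (fun n => (g n)%:C) @ \oo --> l%:C.
Proof.
move=> /cvgrPdist_lt gl; apply/cvgrPdist_lt => -[e1 e2].
rewrite ltcE /= => /andP[/eqP -> e0]; apply: filterS (gl _ e0) => n.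
by rewrite -rmorphB /= normc_def /= expr0n /= addr0 sqrtr_sqr ltcR.
Qed.

Lemma cvg_complex f (l : R[i]) :
  (fun n => complex.Re (f n)) @ \oo --> complex.Re l ->
  (fun n => complex.Im (f n)) @ \oo --> complex.Im l -> f @ \oo --> l.
Proof.
move=> /cvg_real_complex hr /cvg_real_complex hi.
have ci : (fun=> 'i : R[i]) @ \oo --> ('i : R[i]) by exact: cvg_cst.
have := cvgcD hr (cvgcM ci hi); rewrite -complexE.
by apply: eq_cvgc => n; rewrite -complexE.
Qed.

Lemma normRe_le x : `|complex.Re x| <= complex.Re `|x|.
Proof.
rewrite normc_def /= -sqrtr_sqr ler_sqrt ?addr_ge0 ?sqr_ge0 //.
by rewrite lerDl sqr_ge0.
Qed.

Lemma normIm_le x : `|complex.Im x| <= complex.Re `|x|.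
Proof.
rewrite normc_def /= -sqrtr_sqr ler_sqrt ?addr_ge0 ?sqr_ge0 //.
by rewrite lerDr sqr_ge0.
Qed.

Lemma normc_Re x : `|x| = (complex.Re `|x|)%:C.
Proof. by rewrite RRe_real// normr_real. Qed.

Lemma cvg_Re f (l : R[i]) :
  f @ \oo --> l -> (fun n => complex.Re (f n)) @ \oo --> complex.Re l.
Proof.
move=> /cvgrPdist_lt fl; apply/cvgrPdist_lt => e e0.
have := fl e%:C; rewrite ltcR => /(_ e0); apply: filterS => n.
rewrite normc_Re ltcR; apply: le_lt_trans.
by rewrite (_ : _ - _ = complex.Re (l - f n)) ?normRe_le //; case: (l) (f n) => ? ? [].
Qed.

Lemma cvgc0_le f g : (forall n, `|f n| <= (g n)%:C) ->
  g @ \oo --> (0 : R) -> f @ \oo --> (0 : R[i]).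
Proof.
move=> fg /cvgr0Pnorm_lt g0; apply/cvgr0Pnorm_lt => -[e1 e2].
rewrite ltcE /= => /andP[/eqP -> e0]; apply: filterS (g0 _ e0) => n gn.
by apply: le_lt_trans (fg n) _; rewrite ltcR (le_lt_trans (ler_norm _)).
Qed.

(** Induction on [j]: with q = sqrt s, the factor n q^n stays bounded, and n^j q^n tends to 0 by the
    induction hypothesis at q. *)
Lemma cvg_natX_geometric (j : nat) (s : R) : 0 <= s < 1 ->
  (fun n => n%:R ^+ j * s ^+ n) @ \oo --> (0 : R).
Proof.
elim: j s => [|j IH] s /andP[s0 s1].
  rewrite (_ : (fun n => _) = GRing.exp s); first by apply: cvg_expr; rewrite ger0_norm.
  by apply/funext => n; rewrite expr0 mul1r.
pose q := Num.sqrt s; have q0 : 0 <= q by exact: sqrtr_ge0.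
have qs : q ^+ 2 = s by exact: sqr_sqrtr.
have q1 : q < 1 by rewrite -[ltRHS]sqrtr1 ltr_sqrt.
(* Powers of q decrease, so n q^n is at most the sum of q^i over i < n, itself at most 1 / (1 -
   q). *)
have nq n : n%:R * q ^+ n <= (1 - q)^-1.
  rewrite -[leRHS]mul1r ler_pdivlMr ?subr_gt0// mulrC.
  apply: (@le_trans _ _ ((1 - q) * \sum_(i < n) q ^+ i)).
    rewrite ler_wpM2l ?subr_ge0 ?(ltW q1)//.
    rewrite (_ : n%:R * _ = \sum_(i < n) q ^+ n).
      by apply: ler_sum => i _; rewrite ler_wiXn2l ?(ltW q1) ?(ltnW (ltn_ord i)).
    by rewrite sumr_const card_ord mulr_natl.
  by rewrite -opprB mulNr -subrX1 opprB lerBlDr lerDl exprn_ge0.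
have h : (fun n => (n%:R ^+ j * q ^+ n) * (1 - q)^-1) @ \oo --> (0 * (1 - q)^-1 : R).
  by apply: cvgM; [apply: IH; rewrite q0|exact: cvg_cst].
rewrite mul0r in h.
apply: squeeze_cvgr (cvg_cst 0) h.
near=> n; rewrite mulr_ge0 ?exprn_ge0 ?ler0n//=.
rewrite (_ : _ * s ^+ n = (n%:R ^+ j * q ^+ n) * (n%:R * q ^+ n)).
  by rewrite ler_wpM2l// mulr_ge0 ?exprn_ge0 ?ler0n.
by rewrite -qs -exprM mulnC exprM exprSr expr2; ring.
Unshelve. all: by end_near. Qed.

Section BoundedPowerSeries.
Variables (u : nat -> R) (K : R) (x : R[i]).
Hypotheses (uK : forall n, `|u n| <= K) (x1 : `|x| < 1).
Let r := complex.Re `|x|.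

Let xr : `|x| = r%:C. Proof. exact: normc_Re. Qed.

Lemma Renorm_ge0 : 0 <= r. Proof. by rewrite -ler0c -xr. Qed.

Lemma Renorm_lt1 : r < 1. Proof. by rewrite -ltcR -xr. Qed.

Let K0 : 0 <= K. Proof. exact: le_trans (uK 0). Qed.

Lemma normc_real (y : R) : `|y%:C| = `|y|%:C :> R[i].
Proof. by rewrite normc_def /= expr0n /= addr0 sqrtr_sqr. Qed.

Lemma pseries_term_le n : `|(u n)%:C * x ^+ n| <= (K * r ^+ n)%:C.
Proof.
rewrite normrM normc_real normrX xr -rmorphXn -rmorphM /= lecR.
by rewrite ler_wpM2r// exprn_ge0// Renorm_ge0.
Qed.

(** The real and imaginary parts are each dominated by the geometric series K r^n. *)
Lemma is_cvg_bounded_pseries : cvgn (series (fun n => (u n)%:C * x ^+ n)).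
Proof.
have cvgpart (p : R[i] -> R) : (forall y, `|p y| <= complex.Re `|y|) ->
    cvgn (series (fun n => p ((u n)%:C * x ^+ n))).
  move=> hp; apply: normed_cvg.
  apply: (series_le_cvg _ _ _ (@is_cvg_geometric_series _ K r _)) => [n|n|n|].
  - exact: normr_ge0.
  - by rewrite /geometric /= mulr_ge0 ?exprn_ge0 ?Renorm_ge0.
  - apply: le_trans (hp _) _.
    by have := pseries_term_le n; rewrite normc_Re lecR.
  - by rewrite ger0_norm ?Renorm_lt1 ?Renorm_ge0.
have /cvg_ex[/= lr hr] := cvgpart _ normRe_le.
have /cvg_ex[/= li hi] := cvgpart _ normIm_le.
apply/cvg_ex; exists (lr +i* li); apply: cvg_complex => /=.
  rewrite (_ : (fun n => _) = series (fun n => complex.Re ((u n)%:C * x ^+ n))) //.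
  apply/funext => n; rewrite /series /=.
  by apply: (big_morph (fun y => complex.Re y)) => // -[? ?] [? ?].
rewrite (_ : (fun n => _) = series (fun n => complex.Im ((u n)%:C * x ^+ n))) //.
apply/funext => n; rewrite /series /=.
by apply: (big_morph (fun y => complex.Im y)) => // -[? ?] [? ?].
Qed.

(** Each of the [i] terms is crudely bounded by K r^m; the linear factor [i] is harmless in
    [cvg_Cauchy_prod]. *)
Lemma pseries_tail_le m i :
  `|series (fun n => (u n)%:C * x ^+ n) (m + i)%N
    - series (fun n => (u n)%:C * x ^+ n) m| <= (i%:R * K * r ^+ m)%:C.
Proof.
elim: i => [|i IH]; first by rewrite addn0 subrr normr0 !mul0r.
rewrite addnS seriesSr addrAC; apply: le_trans (ler_normD _ _) _.
rewrite -natr1 !mulrDl mul1r rmorphD lerD// (le_trans (pseries_term_le _))//.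
rewrite lecR ler_wpM2l// ler_wiXn2l ?leq_addr ?Renorm_ge0//.
by rewrite ltW ?Renorm_lt1.
Qed.

End BoundedPowerSeries.

(** Both sides sum over the triangle i + j < n, by antidiagonals on the left and by [i] on the
    right. *)
Lemma series_Cauchy_prod (A u : nat -> R) (x : R[i]) n :
  series (fun n => (\sum_(i < n.+1) A i * u (n - i)%N)%:C * x ^+ n) n =
  \sum_(i < n) (A i)%:C * x ^+ i * series (fun n => (u n)%:C * x ^+ n) (n - i)%N.
Proof.
elim: n => [|n IH]; first by rewrite /series /= big_geq// big_ord0.
rewrite seriesSr IH big_ord_recr /= subnn.
rewrite [in RHS]big_ord_recr /= subSnn seriesSr.
rewrite [series _ 0]/series /= big_geq// add0r.
under [in RHS]eq_bigr => i _ do rewrite subSn 1?ltnW// seriesSr mulrDr.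
rewrite big_split /= -!addrA; congr (_ + _).
rewrite rmorphD mulrDl rmorph_sum mulr_suml; congr (_ + _); last first.
  by rewrite rmorphM expr0 mulr1 mulrAC.
apply: eq_bigr => i _; rewrite rmorphM /= mulrACA -exprD subnKC //.
exact: ltnW.
Qed.

(** [E n] is the product of the partial sums minus the partial sum of the product. Its i-th term is
    at most K r^i times i L r^(n-i), so that |E n| <= K L n^2 r^n. *)
Lemma cvg_Cauchy_prod (A u : nat -> R) (K L : R) (x lA lu : R[i]) :
  (forall n, `|A n| <= K) -> (forall n, `|u n| <= L) -> `|x| < 1 ->
  series (fun n => (A n)%:C * x ^+ n) @ \oo --> lA ->
  series (fun n => (u n)%:C * x ^+ n) @ \oo --> lu ->
  series (fun n => (\sum_(i < n.+1) A i * u (n - i)%N)%:C * x ^+ n) @ \oo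
    --> lA * lu.
Proof.
move=> AK uL x1 hA hu; pose r := complex.Re `|x|.
have r0 : 0 <= r := Renorm_ge0 x; have r1 : r < 1 := Renorm_lt1 x1.
have K0 : 0 <= K := le_trans (normr_ge0 _) (AK 0).
have L0 : 0 <= L := le_trans (normr_ge0 _) (uL 0).
pose E n := \sum_(i < n) (A i)%:C * x ^+ i *
  (series (fun n => (u n)%:C * x ^+ n) n
   - series (fun n => (u n)%:C * x ^+ n) (n - i)%N).
have E0 : E @ \oo --> (0 : R[i]).
  apply: (@cvgc0_le _ (fun n => K * L * (n%:R ^+ 2 * r ^+ n))); last first.
    rewrite -[X in _ --> X](mulr0 (K * L)); apply: cvgM; first exact: cvg_cst.
    by apply: cvg_natX_geometric; rewrite r0.
  move=> n; apply: le_trans (ler_norm_sum _ _ _) _.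
  apply: (@le_trans _ _ (\sum_(i < n) (K * L * (n%:R * r ^+ n))%:C)).
    apply: ler_sum => i _; rewrite normrM.
    have h := pseries_tail_le uL x1 (n - i) i.
    rewrite subnK in h; last exact: ltnW.
    apply: le_trans (ler_pM (normr_ge0 _) (normr_ge0 _) (pseries_term_le x AK i) h) _.
    rewrite -rmorphM lecR -/r.
    rewrite [leLHS](_ : _ = K * L * i%:R * r ^+ n); last first.
      have -> : r ^+ n = r ^+ i * r ^+ (n - i) by rewrite -exprD subnKC// ltnW.
      by ring.
    rewrite -!mulrA !ler_wpM2l// ler_wpM2r ?exprn_ge0// ler_nat.
    exact: ltnW.
  rewrite sumr_const card_ord -rmorphMn /= lecR -mulr_natl.
  by rewrite le_eqVlt; apply/orP; left; apply/eqP; ring.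
rewrite -[lA * lu]subr0; apply: eq_cvgc (cvgcB (cvgcM hA hu) E0) => n.
rewrite series_Cauchy_prod /E.
under eq_bigr do rewrite mulrBr.
rewrite big_split /= -mulr_suml sumrN opprD opprK addrA.
by rewrite [series _ n in X in X - _]/series /= big_mkord subrr add0r.
Qed.

End ComplexLimits.

(** * Coefficient sequences: recurrences, bounds and convolution *)

Section Coefficients.
Variable R : realType.
Implicit Types (a : R) (n N k : nat).

Definition hcoef a n : R := poch a n / poch (a + 2^-1) n.
(** Taylor coefficients of (1 - x)^(1/2); those of (1 - x)^(-1/2) are [isqrtcoef]. *)
Definition sqrtcoef n : R := poch (- 2^-1) n / n`!%:R.
Definition isqrtcoef n : R := poch 2^-1 n / n`!%:R.

Lemma pochS (x : R) n : poch x n.+1 = poch x n * (x + n%:R).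
Proof. by rewrite /poch big_ord_recr. Qed.

Lemma poch0 (x : R) : poch x 0 = 1.
Proof. by rewrite /poch big_ord0. Qed.

Lemma half_neq0 a n : (forall m, a <> - (m%:R / 2)) -> a + 2^-1 + n%:R != 0.
Proof.
move=> ha; apply/eqP => h; apply: (ha (n.*2.+1)%N).
by rewrite -addn1 natrD -muln2 natrM; lra.
Qed.

Lemma poch_neq0 a n : (forall m, a <> - (m%:R / 2)) -> poch (a + 2^-1) n != 0.
Proof. by move=> ha; apply/prodf_neq0 => i _; exact: half_neq0. Qed.

Lemma hcoefS a n : (forall m, a <> - (m%:R / 2)) ->
  hcoef a n.+1 * (n%:R + a + 2^-1) = hcoef a n * (n%:R + a).
Proof.
move=> ha; rewrite /hcoef !pochS; have := poch_neq0 n ha; have := half_neq0 n ha.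
set y := poch (_ + _) n => h1 h2.
have h3 : a * 2 + 1 + n%:R * 2 != 0.
  by apply: contra h1 => /eqP h; apply/eqP; lra.
by field; rewrite h2 h3.
Qed.

Lemma sqrtcoefS n : sqrtcoef n.+1 * n.+1%:R = sqrtcoef n * (n%:R - 2^-1).
Proof.
rewrite /sqrtcoef pochS factS natrM.
have h : n`!%:R != 0 :> R by rewrite pnatr_eq0 -lt0n fact_gt0.
have h' : n.+1%:R != 0 :> R by rewrite pnatr_eq0.
by field; rewrite h nat1r h'.
Qed.

Lemma isqrtcoefS n : isqrtcoef n.+1 * n.+1%:R = isqrtcoef n * (n%:R + 2^-1).
Proof.
rewrite /isqrtcoef pochS factS natrM.
have h : n`!%:R != 0 :> R by rewrite pnatr_eq0 -lt0n fact_gt0.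
have h' : n.+1%:R != 0 :> R by rewrite pnatr_eq0.
by field; rewrite h nat1r h'.
Qed.

Lemma sqrtcoef0 : sqrtcoef 0 = 1. Proof. by rewrite /sqrtcoef poch0 divr1. Qed.
Lemma isqrtcoef0 : isqrtcoef 0 = 1. Proof. by rewrite /isqrtcoef poch0 divr1. Qed.
Lemma hcoef0 a : hcoef a 0 = 1. Proof. by rewrite /hcoef !poch0 divr1. Qed.

(** Coefficient form of (1 - x)^(1/2) = (1 - x) (1 - x)^(-1/2). *)
Lemma sqrtcoef_isqrtcoef n : sqrtcoef n.+1 = isqrtcoef n.+1 - isqrtcoef n.
Proof.
have n0 m : m.+1%:R != 0 :> R by rewrite pnatr_eq0.
elim: n => [|n IH].
  have := sqrtcoefS 0; have := isqrtcoefS 0.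
  by rewrite sqrtcoef0 isqrtcoef0; lra.
apply: (mulIf (n0 n.+1)); rewrite sqrtcoefS IH [in RHS]mulrBl isqrtcoefS.
have := isqrtcoefS n; rewrite -(natr1 n.+1) -(natr1 n).
by move: (isqrtcoef n.+1) (isqrtcoef n) (n%:R : R) => x y m h; nra.
Qed.

Lemma hcoef_half n : hcoef 2^-1 n = isqrtcoef n.
Proof.
rewrite /hcoef /isqrtcoef (_ : 2^-1 + 2^-1 = 1); last by field.
congr (_ / _).
elim: n => [|n IH]; first by rewrite poch0.
by rewrite pochS IH factS natrM nat1r mulrC.
Qed.

Lemma isqrtcoef_gt0 n : 0 < isqrtcoef n.
Proof.
rewrite /isqrtcoef divr_gt0 ?ltr0n ?fact_gt0//; apply: prodr_gt0 => i _.
by rewrite ltr_pwDl.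
Qed.

Lemma isqrtcoefS_le n : isqrtcoef n.+1 <= isqrtcoef n.
Proof.
have n0 : 0 < n.+1%:R :> R by rewrite ltr0n.
rewrite -(ler_pM2r n0) isqrtcoefS -(natr1 n) ler_wpM2l ?(ltW (isqrtcoef_gt0 n))//.
lra.
Qed.

Lemma isqrtcoef_le1 n : isqrtcoef n <= 1.
Proof.
by elim: n => [|n]; rewrite ?isqrtcoef0//; apply: le_trans; exact: isqrtcoefS_le.
Qed.

(** Written as a difference so that sums of these norms telescope, as [Re_sqrt_series_gt0]
    requires. *)
Lemma sqrtcoef_norm n : `|sqrtcoef n.+1| = isqrtcoef n - isqrtcoef n.+1.
Proof.
by rewrite sqrtcoef_isqrtcoef distrC ger0_norm// subr_ge0 isqrtcoefS_le.
Qed.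

Lemma sqrtcoef_bounded n : `|sqrtcoef n| <= 1.
Proof.
case: n => [|n]; first by rewrite sqrtcoef0 normr1.
rewrite sqrtcoef_norm; have := isqrtcoef_le1 n; have := isqrtcoef_gt0 n.+1; lra.
Qed.

(** The ratio (n + a) / (n + a + 1/2) of consecutive coefficients lies in [0, 1] once n > |a|. *)
Lemma hcoef_bounded a : (forall m, a <> - (m%:R / 2)) ->
  exists K, forall n, `|hcoef a n| <= K.
Proof.
move=> ha; pose M := Num.truncn `|a|.
have dec n : (M < n)%N -> `|hcoef a n.+1| <= `|hcoef a n|.
  move=> Mn; have an : 0 <= n%:R + a.
    have : `|a| < n%:R by rewrite (lt_le_trans (truncnS_gt _))// ler_nat.
    by rewrite ltr_norml => /andP[+ _]; lra.
  have d0 : 0 < n%:R + a + 2^-1 by lra.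
  rewrite -(ler_pM2r d0) -[X in _ * X](ger0_norm (ltW d0)) -normrM hcoefS//.
  by rewrite normrM (ger0_norm an) ler_wpM2l//; lra.
(* The norms are nonincreasing from index M + 1 on, so the terms up to that index bound all the
   others. *)
exists (\sum_(i < M.+2) `|hcoef a i|) => n.
have base m : (m < M.+2)%N -> `|hcoef a m| <= \sum_(i < M.+2) `|hcoef a i|.
  move=> h; rewrite (bigD1 (Ordinal h))//= lerDl sumr_ge0//.
have [/base//|] := ltnP n M.+2.
elim: n => // n IH; rewrite leq_eqVlt => /orP[/eqP[<-]|Mn].
  by apply: le_trans (dec _ _) (base _ _).
by apply: le_trans (dec _ _) (IH _) => //; rewrite -ltnS ltnW.
Qed.

(* Coefficient form of the differential equations of sqrt (1 - x) and of
   F = sum_n hcoef a n x^n, combined for their product. *)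
Lemma sqrt_hcoef_conv a n : (forall m, a <> - (m%:R / 2)) ->
  (n%:R + a - 2^-1) * \sum_(i < n.+1) sqrtcoef i * hcoef a (n - i)%N =
  (a - 2^-1) * isqrtcoef n.
Proof.
move=> ha.
(* With A and F the series of [sqrtcoef] and [hcoef a], these are the coefficients of A F and x A'
   F; [dS] expresses (1 - x) A' = - A / 2. *)
pose c n := \sum_(i < n.+1) sqrtcoef i * hcoef a (n - i)%N.
pose d n := \sum_(i < n.+1) i%:R * sqrtcoef i * hcoef a (n - i)%N.
have dS m : d m.+1 = d m - c m / 2.
  rewrite /d big_ord_recl /= !mul0r add0r /c mulr_suml -sumrB.
  apply: eq_bigr => i _; rewrite /bump /= add1n subSS [_ * sqrtcoef _]mulrC sqrtcoefS.
  by field.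
(* Coefficient of x^(m+1) in A times the equation x F' + (a - 1/2) F - x (x F' + a F) = a - 1/2,
   with A x F' written as x (A F)' - x A' F. *)
have cS m : (m%:R + a + 2^-1) * c m.+1 - d m.+1 =
    (m%:R + a) * c m - d m + (a - 2^-1) * sqrtcoef m.+1.
  rewrite /c /d !mulr_sumr -!sumrB big_ord_recr /= subnn hcoef0 -(natr1 m).
  congr (_ + _); last by field.
  apply: eq_bigr => i _; have im : (i <= m)%N by rewrite -ltnS.
  rewrite subSn//; have := hcoefS (m - i) ha; rewrite natrB//.
  move: (hcoef a (m - i).+1) (hcoef a (m - i)%N) (sqrtcoef i) => p q s h.
  rewrite [LHS](_ : _ = s * (p * (m%:R - i%:R + a + 2^-1))); last by ring.
  by rewrite h; ring.
rewrite -/(c n); elim: n => [|n IH].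
  by rewrite /c big_ord_recl big_ord0 /= sqrtcoef0 hcoef0 isqrtcoef0; ring.
have := cS n; rewrite dS sqrtcoef_isqrtcoef -(natr1 n).
move: (c n.+1) (c n) (d n) (isqrtcoef n.+1) (isqrtcoef n) IH => x y z b b' IH h.
rewrite (_ : _ * x = (n%:R + a - 2^-1) * y + (a - 2^-1) * (b - b')).
  by rewrite IH; ring.
by move: h; lra.
Qed.

(** Multiplication by n + a - 1/2 turns (a - 1/2)_n into (a - 1/2) (a + 1/2)_n and reduces the claim
    to [sqrt_hcoef_conv]. At n = 0 this factor vanishes if a = 1/2, hence the separate case. *)
Lemma Euler_coef a n : (forall m, a <> - (m%:R / 2)) ->
  \sum_(i < n.+1) sqrtcoef i * hcoef a (n - i)%N =
  poch 2^-1 n * poch (a - 2^-1) n / (poch (a + 2^-1) n * n`!%:R).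
Proof.
move=> ha; case: n => [|n].
  by rewrite big_ord_recl big_ord0 /= sqrtcoef0 hcoef0 !poch0 fact0 !mulr1 divr1 addr0.
have n0 : n.+1%:R + a - 2^-1 != 0.
  have := half_neq0 n ha; apply: contra => /eqP; rewrite -(natr1 n) => h.
  by apply/eqP; lra.
apply: (mulfI n0); rewrite sqrt_hcoef_conv// /isqrtcoef.
have hp : poch (a - 2^-1) n.+1 * (n.+1%:R + a - 2^-1) =
    (a - 2^-1) * poch (a + 2^-1) n.+1.
  rewrite [X in X * _]/poch big_ord_recl /= addr0 -mulrA; congr (_ * _).
  rewrite /poch [in RHS]big_ord_recr /=; congr (_ * _).
    by apply: eq_bigr => i _; rewrite /bump /= add1n -(natr1 i); field.
  by rewrite -(natr1 n); field.
have h : n.+1`!%:R != 0 :> R by rewrite pnatr_eq0 -lt0n fact_gt0.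
have h' := poch_neq0 n.+1 ha.
move: (poch (a + 2^-1) _) hp h' => y hp h'.
rewrite [RHS](_ : _ = poch 2^-1 n.+1 *
  (poch (a - 2^-1) n.+1 * (n.+1%:R + a - 2^-1)) / (y * n.+1`!%:R)); last by ring.
by rewrite hp; field; rewrite h h'.
Qed.
End Coefficients.

(** * The polynomial identity for truncations of F *)

Section PolynomialIdentity.
Variables (R : realType) (a : R).
Hypothesis ha : forall m : nat, a <> - (m%:R / 2).
Implicit Types (p t : {poly R}) (W : {poly {poly R}}) (n N k : nat).

Definition theta p : {poly R} := 2 * 'X * p^`() + (2 * a)%:P * p.

Definition hpoly k N : {poly R} :=
  \sum_(n < N) ((2 * (n%:R + a)) ^+ k * hcoef a n)%:P * 'X^n.

(** Coefficient of the boundary term that truncation at N leaves in (1 - x) theta F = F + 2a - 1. *)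
Definition hrest N : R := (2 * N%:R + 2 * a - 1) * hcoef a N.

Lemma mulX_derivXn n : 'X * ('X^n)^`() = n%:R * 'X^n :> {poly R}.
Proof.
case: n => [|n]; first by rewrite expr0 derivC mulr0 mul0r.
by rewrite derivXn /= exprS -mulr_natl; ring.
Qed.

Lemma theta_sum (I : Type) (r : seq I) (F : I -> {poly R}) :
  theta (\sum_(i <- r) F i) = \sum_(i <- r) theta (F i).
Proof.
apply: (big_morph theta) => [p q|]; last by rewrite /theta derivC !mulr0 addr0.
by rewrite /theta derivD; ring.
Qed.

Lemma theta_hpoly k N : theta (hpoly k N) = hpoly k.+1 N.
Proof.
rewrite theta_sum; apply: eq_bigr => n _.
rewrite /theta derivM derivC mul0r add0r.
move: (mulX_derivXn n) => h.
rewrite [LHS](_ : _ = 2 * ((2 * (n%:R + a)) ^+ k * hcoef a n)%:P *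
  ('X * ('X^n)^`()) + (2 * a)%:P * ((2 * (n%:R + a)) ^+ k * hcoef a n)%:P * 'X^n).
  by rewrite h exprS; ring.
by ring.
Qed.

Lemma hpoly1E N :
  (1 - 'X) * hpoly 1 N = hpoly 0 N + (2 * a - 1)%:P - (hrest N)%:P * 'X^N.
Proof.
elim: N => [|N IH].
  by rewrite /hpoly !big_ord0 /hrest hcoef0; ring.
rewrite /hpoly !big_ord_recr /= -!/(hpoly _ _) mulrDr IH expr1 expr0 mul1r.
have -> : hrest N.+1 = 2 * (N%:R + a) * hcoef a N.
  rewrite /hrest -mulrA [_ * hcoef a N]mulrC -hcoefS// -(natr1 N).
  by field.
by rewrite /hrest exprS; ring.
Qed.

Lemma onesubX_deriv k :
  (1 - 'X) * ((1 - 'X) ^+ k)^`() = - k%:R * (1 - 'X) ^+ k :> {poly R}.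
Proof.
case: k => [|k]; first by rewrite expr0 derivC mulr0 oppr0 mul0r.
rewrite deriv_exp derivB derivC derivX exprS -mulr_natl /=; ring.
Qed.

(** The outer variable of [W] stands for N and the inner one for x. Differentiating the coefficients
    in x commutes with setting the outer variable to a constant, so one [W'] serves every N. *)
Lemma horner_deriv_coef W :
  exists W', forall c : R, W'.[c%:P] = (W.[c%:P])^`().
Proof.
elim/poly_ind: W => [|W p [W' hW]]; first by exists 0 => c; rewrite !horner0 derivC.
exists (W' * 'X + (p^`())%:P) => c.
by rewrite !hornerE hW derivD derivM derivC mulr0 addr0.
Qed.

(* The induction step: [theta] multiplies the n-th term of [hpoly k N] by
   2 (n + a), and [hpoly1E] eliminates [theta (hpoly 0 N)]. *)
Lemma hpolyE k : exists W, forall N,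
  (1 - 'X) ^+ k * hpoly k N =
  (2 * a - 1)%:P * HCBp a k + HCBq R k * hpoly 0 N
  + (hrest N)%:P * 'X^N * W.[(N%:R)%:P].
Proof.
elim: k => [|k [W IH]].
  by exists 0 => N; rewrite expr0 /= horner0; ring.
have [W' hW'] := horner_deriv_coef W.
(* Image of the old remainder under [e1]: a bare ['X] stands for N and comes from x (x^N)' = N x^N,
   while ['X] under [%:P] is x. The last term is the boundary term of [hpoly1E]. *)
exists ((1 - 'X)%:P * (2 * 'X%:P * W' + (2 * 'X + (2 * a)%:P%:P) * W)
  + (2 * k%:R * 'X)%:P * W - (HCBq R k)%:P) => N.
set S := hpoly k N; set U := hpoly 0 N; set c := 1 - 'X.
have e1 : c ^+ k.+1 * hpoly k.+1 N =
    c * theta (c ^+ k * S) + 2 * k%:R * 'X * (c ^+ k * S).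
  rewrite -theta_hpoly /theta derivM exprS.
  have := onesubX_deriv k; rewrite -/c; move: ((c ^+ k)^`()) => D h.
  rewrite [RHS](_ : _ = 2 * 'X * S * (c * D) + c * c ^+ k * theta S
    + 2 * k%:R * 'X * (c ^+ k * S)); last by rewrite /theta; ring.
  by rewrite h /theta -/S; ring.
rewrite e1 IH.
rewrite !hornerE hW' /theta !derivD !derivM !derivC.
have := hpoly1E N; rewrite -theta_hpoly /theta -/U -/c.
have := mulX_derivXn N.
rewrite [HCBp a k.+1]/= [HCBq R k.+1]/= -!mul_polyC.
move: (HCBp a k)^`() (HCBp a k) (HCBq R k)^`() (HCBq R k) => P' P Q' Q.
move: (W.[(N%:R)%:P])^`() W.[(N%:R)%:P] U^`() ('X^N)^`() => w' w U' x' hx hU.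
apply/eqP; rewrite -subr_eq0; apply/eqP.
(* The difference of the two sides is a combination of the relations [hU] and [hx] with these
   cofactors. *)
transitivity (Q * (c * (2 * 'X * U' + (2 * a)%:P * U)
      - (U + (2 * a - 1)%:P - (hrest N)%:P * 'X^N))
    + 2 * c * (hrest N)%:P * w * ('X * x' - N%:R * 'X^N)).
  by rewrite /c; ring.
by rewrite hx hU !subrr !mulr0 addr0.
Qed.
End PolynomialIdentity.

(** * Passage to the limit in the polynomial identity *)

Section SeriesLimits.
Local Open Scope classical_set_scope.
Variable R : realType.
Implicit Types (a : R) (x : R[i]) (g : nat -> R[i]).

Lemma cevalD (p q : {poly R}) x : ceval (p + q) x = ceval p x + ceval q x.
Proof. by rewrite /ceval rmorphD hornerD. Qed.

Lemma cevalM (p q : {poly R}) x : ceval (p * q) x = ceval p x * ceval q x.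
Proof. by rewrite /ceval rmorphM hornerM. Qed.

Lemma cevalC (c : R) x : ceval c%:P x = c%:C.
Proof. by rewrite /ceval map_polyC hornerC. Qed.

Lemma cevalXn n x : ceval 'X^n x = x ^+ n :> R[i].
Proof. by rewrite /ceval map_polyXn hornerXn. Qed.

Lemma ceval_onesubX k x : ceval ((1 - 'X) ^+ k) x = (1 - x) ^+ k :> R[i].
Proof.
by rewrite /ceval rmorphXn rmorphB rmorph1 /= map_polyX horner_exp !hornerE.
Qed.

Lemma ceval_hpoly a k N x : ceval (hpoly a k N) x =
  series (fun n => ((2 * (n%:R + a)) ^+ k * hcoef a n)%:C * x ^+ n) N.
Proof.
rewrite /series /= big_mkord /hpoly.
rewrite (big_morph (fun p => ceval p x) (fun p q => cevalD p q x) (cevalC 0 x)).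
by apply: eq_bigr => n _; rewrite cevalM cevalC cevalXn.
Qed.

Lemma cvgc_cst (l : R[i]) : (fun _ : nat => l) @ \oo --> l.
Proof. exact: cvg_cst. Qed.
(* The convergence unfolds to a product over which l would be implicit. *)
Arguments cvgc_cst l : clear implicits.

Lemma cvgc_shiftS (f : nat -> R[i]) (l : R[i]) :
  (fun n => f n.+1) @ \oo --> l <-> f @ \oo --> l.
Proof. by rewrite (cvg_shiftS f). Qed.

(** Induction on [W]: each outer degree costs one power of N, which the hypothesis absorbs as it
    holds for all [j]. *)
Lemma cvg0_ceval_horner (W : {poly {poly R}}) x g :
  (forall j, (fun N => N%:R ^+ j * g N) @ \oo --> (0 : R[i])) ->
  (fun N => g N * ceval W.[N%:R%:P] x) @ \oo --> (0 : R[i]).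
Proof.
elim/poly_ind: W g => [|W p IH] g hg.
  apply: (eq_cvgc _ (cvgc_cst 0)) => N.
  by rewrite horner0 /ceval rmorph0 horner0 mulr0.
have h1 : (fun N => N%:R * g N * ceval W.[N%:R%:P] x) @ \oo --> (0 : R[i]).
  by apply: IH => j; apply: (eq_cvgc _ (hg j.+1)) => N; rewrite exprSr mulrA.
have := cvgcD h1 (cvgcM (hg 0%N) (cvgc_cst (ceval p x))).
rewrite mul0r addr0; apply: eq_cvgc => N.
rewrite !hornerE cevalD cevalM cevalC rmorph_nat /=; ring.
Qed.

(** [hrest a N] grows at most linearly, because [hcoef a] is bounded, and r^N beats every power of
    N. *)
Lemma cvg0_hrest a x : (forall m : nat, a <> - (m%:R / 2)) -> `|x| < 1 ->
  forall j, (fun N => N%:R ^+ j * ((hrest a N)%:C * x ^+ N)) @ \oo --> (0 : R[i]).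
Proof.
move=> ha x1 j; have [K hK] := hcoef_bounded ha.
pose r := complex.Re `|x|.
have r01 : 0 <= r < 1 by rewrite Renorm_ge0 Renorm_lt1.
have K0 : 0 <= K := le_trans (normr_ge0 _) (hK 0%N).
have h1 := @cvg_natX_geometric R j.+1 r r01.
have h2 := @cvg_natX_geometric R j r r01.
apply: (@cvgc0_le _ _ (fun N => 2 * K * (N%:R ^+ j.+1 * r ^+ N)
  + `|2 * a - 1| * K * (N%:R ^+ j * r ^+ N))); last first.
  have := cvgD (cvgM (@cvg_cst R (2 * K) nat \oo _) h1)
    (cvgM (@cvg_cst R (`|2 * a - 1| * K) nat \oo _) h2).
  rewrite !mulr0 addr0; exact.
move=> N; rewrite normrM normrX normr_nat normrM normc_real normrX normc_Re -/r.
rewrite -(rmorph_nat (real_complex R)) -!(rmorphXn (real_complex R)) -!rmorphM lecR.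
rewrite [leRHS](_ : _ = N%:R ^+ j * ((2 * N%:R + `|2 * a - 1|) * K * r ^+ N)).
  rewrite ler_wpM2l ?exprn_ge0// ler_wpM2r ?exprn_ge0 ?(andP r01).1//.
  rewrite /hrest normrM ler_pM//.
  by rewrite -addrA (le_trans (ler_normD _ _))// lerD2r ger0_norm// mulr_ge0.
by rewrite exprS; ring.
Qed.

(** [hpolyE] evaluated at x and divided by (1 - x)^k; its remainder tends to 0. *)
Lemma cvg_hpoly a k x lF : (forall m : nat, a <> - (m%:R / 2)) -> `|x| < 1 ->
  series (fun n => (hcoef a n)%:C * x ^+ n) @ \oo --> lF ->
  series (fun n => ((2 * (n%:R + a)) ^+ k * hcoef a n)%:C * x ^+ n) @ \oo -->
  ((2 * a%:C - 1) * ceval (HCBp a k) x + ceval (HCBq R k) x * lF) / (1 - x) ^+ k.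
Proof.
move=> ha x1 hF; have [W hW] := hpolyE ha k.
have x0 : 1 - x != 0.
  by apply: contraTneq x1 => /subr0_eq <-; rewrite normr1 ltxx.
have h := cvgcM (cvgcD (cvgcD
  (cvgc_cst ((2 * a%:C - 1) * ceval (HCBp a k) x))
  (cvgcM (cvgc_cst (ceval (HCBq R k) x)) hF))
  (@cvg0_ceval_horner W x _ (cvg0_hrest ha x1))) (cvgc_cst ((1 - x) ^- k)).
rewrite addr0 in h; apply: (eq_cvgc _ h) => N.
apply: (mulIf (expf_neq0 k x0)); rewrite mulfVK ?expf_neq0//; symmetry.
rewrite -ceval_hpoly -ceval_onesubX mulrC -cevalM hW !cevalD !cevalM !cevalC.
rewrite cevalXn ceval_hpoly; congr (_ * _ + _ * _ + _).
  by rewrite rmorphB rmorphM rmorph1 rmorph_nat.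
by congr (series _ N); apply/funext => n; rewrite expr0 mul1r.
Qed.

(** * The binomial series as a square root of 1 - x *)

Section SquareRoot.
Variables (x lA : R[i]).
Hypotheses (x1 : `|x| < 1)
  (hA : series (fun n => (sqrtcoef R n)%:C * x ^+ n) @ \oo --> lA).

Let half_ok (m : nat) : (2^-1 : R) <> - (m%:R / 2).
Proof.
move=> h; have : 0 <= m%:R / 2 :> R by rewrite divr_ge0.
by rewrite -[m%:R / 2]opprK -h; lra.
Qed.

Lemma series_isqrtcoef N :
  (1 - x) * series (fun n => (isqrtcoef R n)%:C * x ^+ n) N.+1 =
  series (fun n => (sqrtcoef R n)%:C * x ^+ n) N.+1
  - (isqrtcoef R N)%:C * x ^+ N.+1.
Proof.
elim: N => [|N IH].
  by rewrite /series /= !big_nat1 sqrtcoef0 isqrtcoef0 expr0 expr1; ring.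
rewrite !(seriesSr _ N.+1) mulrDr IH sqrtcoef_isqrtcoef rmorphB /= !(exprS x N.+1).
set s := series _ _; ring.
Qed.

(** With B the sum of the [isqrtcoef] series, A B = 1 and (1 - x) B = A, whence A^2 = (1 - x) B A =
    1 - x. *)
Lemma sqr_sqrt_series : lA ^+ 2 = 1 - x.
Proof.
have b1 n : `|isqrtcoef R n| <= 1.
  by rewrite gtr0_norm ?isqrtcoef_gt0// isqrtcoef_le1.
have /cvg_ex[/= lB hB] := is_cvg_bounded_pseries b1 x1.
have hAB := cvg_Cauchy_prod (@sqrtcoef_bounded R) b1 x1 hA hB.
have lAB : lA * lB = 1.
  apply: (cvg_unique _ hAB); first exact: norm_hausdorff.
  apply/cvgc_shiftS; apply: (eq_cvgc _ (cvgc_cst 1)) => N.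
  rewrite /series /= big_nat_recl// big_ord_recl big_ord0 sqrtcoef0 isqrtcoef0.
  rewrite mulr1 addr0 expr0 mulr1 big1_seq ?addr0// => n _.
  (* At a = 1/2, [Euler_coef] carries the factor (0)_(n+1) = 0, so only the constant coefficient of
     A B survives. *)
  under eq_bigr do rewrite -hcoef_half.
  rewrite Euler_coef// subrr (_ : poch 0 n.+1 = 0) ?mulr0 ?mul0r//.
  by rewrite /poch big_ord_recl addr0 mul0r.
have hlB : (1 - x) * lB = lA.
  have bN : (fun N => (isqrtcoef R N)%:C * x ^+ N.+1) @ \oo --> (0 : R[i]).
    have h : (fun N => (isqrtcoef R N)%:C * x ^+ N) @ \oo --> (0 : R[i]).
      apply: (@cvgc0_le _ _ (fun N => (N%:R ^+ 0 * (complex.Re `|x|) ^+ N))).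
        by move=> N; rewrite expr0; exact: pseries_term_le.
      by apply: cvg_natX_geometric; rewrite Renorm_ge0 Renorm_lt1.
    have := cvgcM h (cvgc_cst x); rewrite mul0r; apply: eq_cvgc => N.
    by rewrite exprSr mulrA.
  have h1 := cvgcM (cvgc_cst (1 - x)) (iffRL (cvgc_shiftS _ _) hB).
  have h2 := cvgcB (iffRL (cvgc_shiftS _ _) hA) bN.
  rewrite subr0 in h2; apply: (cvg_unique _ h1); first exact: norm_hausdorff.
  by apply: eq_cvgc h2 => N; rewrite series_isqrtcoef.
by rewrite expr2 -{1}hlB -mulrA [lB * _]mulrC lAB mulr1.
Qed.

(** Since |x^i| <= r for i >= 1 and the coefficient norms telescope, the partial sums stay within r
    of 1, so Re A >= 1 - r. *)
Lemma Re_sqrt_series_gt0 : 0 < complex.Re lA.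
Proof.
pose r := complex.Re `|x|.
have r0 : 0 <= r := Renorm_ge0 x; have r1 : r < 1 := Renorm_lt1 x1.
pose S := series (fun n => (sqrtcoef R n)%:C * x ^+ n).
have bound N : `|1 - S N.+1| <= (r * (1 - isqrtcoef R N))%:C.
  elim: N => [|N IH].
    by rewrite /S /series /= big_nat1 sqrtcoef0 isqrtcoef0 expr0 mulr1 !subrr mulr0 normr0.
  rewrite /S seriesSr opprD addrA (le_trans (ler_normB _ _))//.
  rewrite (_ : r * _ = r * (1 - isqrtcoef R N) +
    r * (isqrtcoef R N - isqrtcoef R N.+1)); last by ring.
  rewrite rmorphD lerD// normrM normc_real normrX normc_Re -/r sqrtcoef_norm.
  rewrite -rmorphXn -rmorphM lecR [leRHS]mulrC ler_wpM2l ?subr_ge0 ?isqrtcoefS_le//.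
  by rewrite exprS ler_piMr// exprn_ile1// ltW.
apply: (@lt_le_trans _ _ (1 - r)); first by rewrite subr_gt0.
have hRe : (fun n => complex.Re (S n.+1)) @ \oo --> complex.Re lA.
  by apply: cvg_Re; apply/cvgc_shiftS.
rewrite -(cvg_lim _ hRe)//; apply: limr_ge; first by apply/cvg_ex; exists (complex.Re lA).
near=> n; have := bound n; rewrite normc_Re lecR => h.
have := le_trans (normRe_le _) h; rewrite ler_norml => /andP[_].
have -> : complex.Re (1 - S n.+1) = 1 - complex.Re (S n.+1) by case: (S _).
have : r * (1 - isqrtcoef R n) <= r.
  by rewrite ler_piMr// gerBl ltW// isqrtcoef_gt0.
lra.
Unshelve. all: by end_near. Qed.
End SquareRoot.
End SeriesLimits.
Arguments cvgc_cst {R} l.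

(** * Principal logarithm and powers *)

Section ComplexPower.
Variable R : realType.
Implicit Types (w z : R[i]) (t : R).

Lemma cexpD w z : cexp (w + z) = cexp w * cexp z.
Proof.
case: w z => [a b] [c d]; rewrite /cexp /= expRD cosD sinD.
by simpc; congr (_ +i* _); ring.
Qed.

Lemma cexp0 : cexp (0 : R[i]) = 1.
Proof. by rewrite /cexp /= expR0 cos0 sin0; simpc. Qed.

Lemma cexp_neq0 w : cexp w != 0.
Proof.
apply/eqP => h; have := cexpD w (- w).
by rewrite subrr cexp0 h mul0r => /eqP; rewrite oner_eq0.
Qed.

Lemma cexpN w : cexp (- w) = (cexp w)^-1.
Proof.
apply: (mulfI (cexp_neq0 w)); rewrite -cexpD subrr cexp0 mulfV//.
exact: cexp_neq0.
Qed.

Lemma cexpMn n w : cexp (n%:R * w) = cexp w ^+ n.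
Proof.
elim: n => [|n IH]; first by rewrite mul0r cexp0.
by rewrite -natr1 mulrDl mul1r cexpD IH exprSr.
Qed.

Lemma normc_gt0 w : w != 0 -> 0 < Normc.normc w.
Proof.
move=> w0; have : 0 < `|w| by rewrite normr_gt0.
by rewrite -[`|w|]/((Normc.normc w)%:C) ltcR.
Qed.

Lemma normc_sqr w :
  Normc.normc w ^+ 2 = complex.Re w ^+ 2 + complex.Im w ^+ 2.
Proof. by case: w => a b /=; rewrite sqr_sqrtr ?addr_ge0 ?sqr_ge0. Qed.

Lemma Re_ratio_bounds w : w != 0 -> -1 <= complex.Re w / Normc.normc w <= 1.
Proof.
move=> w0; have n0 := normc_gt0 w0.
rewrite ler_pdivlMr// ler_pdivrMr// mulN1r mul1r -ler_norml.
exact: normRe_le.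
Qed.

Lemma carg_bounds w : w != 0 -> - pi <= carg w <= pi.
Proof.
move=> /Re_ratio_bounds h; rewrite /carg.
have := acos_ge0 h; have := acos_lepi h; case: ifP => _; lra.
Qed.

Lemma cos_carg w : w != 0 -> cos (carg w) = complex.Re w / Normc.normc w.
Proof.
move=> /Re_ratio_bounds h; rewrite /carg.
by case: ifP => _; rewrite ?cosN acosK// in_itv.
Qed.

Lemma sin_carg w : w != 0 -> sin (carg w) = complex.Im w / Normc.normc w.
Proof.
move=> w0; have h := Re_ratio_bounds w0; have n0 := normc_gt0 w0.
have e : sin (acos (complex.Re w / Normc.normc w)) =
    `|complex.Im w| / Normc.normc w.
  have r0 : 0 <= `|complex.Im w| / Normc.normc w by rewrite divr_ge0// ltW.
  rewrite sin_acos// -[RHS](ger0_norm r0) -[RHS]sqrtr_sqr.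
  apply: (congr1 Num.sqrt).
  rewrite !expr_div_n real_normK ?num_real //.
  have n2 : Normc.normc w ^+ 2 != 0 by rewrite expf_neq0// gt_eqF.
  by apply: (mulIf n2); rewrite mulrBl !mulfVK// mul1r normc_sqr addrC addKr.
rewrite /carg; case: ifP => Iw; rewrite ?sinN e; first by rewrite ger0_norm.
by rewrite ltr0_norm ?ltNge ?Iw// mulNr opprK.
Qed.

Lemma clogK w : w != 0 -> cexp (clog w) = w.
Proof.
move=> w0; have n0 := normc_gt0 w0.
rewrite /cexp /= lnK ?posrE// cos_carg// sin_carg//.
case: w w0 n0 => a b _ n0; simpc.
by congr (_ +i* _); rewrite mulrC divfK ?gt_eqF.
Qed.

(** Half the principal argument lies in [-pi/2, pi/2], where the cosine is nonnegative. *)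
Lemma Re_sqrt_ge0 w : w != 0 -> 0 <= complex.Re (cpow w 2^-1).
Proof.
move=> w0; rewrite /cpow (negbTE w0) /cexp.
have -> : 2^-1 = (2^-1 : R)%:C by rewrite fmorphV rmorph_nat.
rewrite /clog; simpc => /=; rewrite mulr_ge0 ?expR_ge0 ?cos_ge0_pihalf//.
have /andP[h1 h2] := carg_bounds w0; lra.
Qed.

Lemma sqr_sqrtc w : w != 0 -> cpow w 2^-1 ^+ 2 = w.
Proof.
move=> w0; rewrite /cpow (negbTE w0) -cexpMn mulrA mulfV ?pnatr_eq0// mul1r.
exact: clogK.
Qed.

Lemma cpow_halfE w y : w != 0 -> y ^+ 2 = w -> 0 < complex.Re y ->
  cpow w 2^-1 = y.
Proof.
move=> w0 yw y0; have /eqP := sqr_sqrtc w0; rewrite -yw eqf_sqr => /orP[/eqP//|/eqP h].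
have := Re_sqrt_ge0 w0; rewrite -yw h.
by case: y {yw h} y0 => a b /= y0; rewrite oppr_ge0 leNgt y0.
Qed.

Lemma cpowDn w n z : w != 0 -> cpow w (n%:R + z) = w ^+ n * cpow w z.
Proof. by move=> w0; rewrite /cpow (negbTE w0) mulrDl cexpD cexpMn clogK. Qed.

Lemma cpow_1subn w n : w != 0 -> cpow w (1 - n%:R) = w / w ^+ n.
Proof.
by move=> w0; rewrite /cpow (negbTE w0) mulrBl mul1r cexpD cexpN cexpMn clogK.
Qed.

(** A positive real factor leaves the argument unchanged, so no branch jump occurs. *)
Lemma cpow_real_mul t w z : 0 < t -> w != 0 ->
  cpow (t%:C * w) z = cpow t%:C z * cpow w z.
Proof.
move=> t0 w0; have t0' : t%:C != 0 by rewrite fmorph_eq0 gt_eqF.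
rewrite /cpow mulf_eq0 !(negbTE w0) !(negbTE t0') /= -cexpD -mulrDr.
congr (cexp (_ * _)); rewrite /clog Normc.normcM lnM ?posrE ?normc_gt0//; simpc.
have nt : Normc.normc t%:C = t by rewrite /= expr0n /= addr0 sqrtr_sqr gtr0_norm.
have -> : carg t%:C = 0 by rewrite /carg nt /= divff ?gt_eqF// acos1 lexx.
congr (_ +i* _); rewrite add0r /carg Normc.normcM nt.
have [-> ->] : complex.Re (t%:C * w) = t * complex.Re w /\
    complex.Im (t%:C * w) = t * complex.Im w.
  by case: (w) => a b; simpc.
by rewrite pmulr_rge0// -mulf_div divff ?gt_eqF// mul1r.
Qed.
End ComplexPower.

(** * The terms of [PhiHCB] *)

Section HCBTerm.
Variable R : realType.
Variable a : R.
Hypothesis ha : forall m : nat, a <> - (m%:R / 2).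

(** Together with [nat_pole], this keeps every Gamma value in the binomials off the poles: equality
    would force a = -(2n + m + 1)/2. *)
Lemma double_pole n m : 2 * (n%:R + a) + 1 != - m%:R.
Proof.
apply/eqP => h; apply: (@ha (n.*2 + m).+1%N).
by rewrite -natr1 natrD -muln2 natrM; lra.
Qed.

Lemma nat_pole n m : n%:R + a != - m%:R.
Proof.
apply/eqP => h; apply: (@ha (n + m).*2%N).
by rewrite -muln2 natrM natrD; lra.
Qed.

Lemma natDa_neq0 n : n%:R + a != 0.
Proof. by have := nat_pole n 0; rewrite oppr0. Qed.

Lemma natDaC_neq0 n : n%:R + a%:C != 0 :> R[i].
Proof.
by rewrite -(rmorph_nat (real_complex R)) -rmorphD fmorph_eq0 natDa_neq0.
Qed.

Let cb n : R := rbinom (2 * (n%:R + a)) (n%:R + a).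

Lemma cbE n : cb n = Gamma (2 * (n%:R + a) + 1) / Gamma (n%:R + a + 1) ^+ 2.
Proof. by rewrite /cb /rbinom; congr (_ / (_ * Gamma _)); ring. Qed.

Lemma natDaS n : n%:R + a + 1 = n.+1%:R + a.
Proof. by rewrite -natr1; ring. Qed.

Lemma cb_neq0 n : cb n != 0.
Proof.
rewrite cbE mulf_neq0 ?invr_eq0 ?expf_neq0 ?Gamma_neq0// => m.
- exact: double_pole.
- by rewrite natDaS nat_pole.
Qed.

Lemma cbS n : cb n.+1 * (n.+1%:R + a) = cb n * (2 * (2 * (n%:R + a) + 1)).
Proof.
rewrite !cbE.
have -> : 2 * (n.+1%:R + a) + 1 = 2 * (n%:R + a) + 1 + 1 + 1.
  by rewrite -(natr1 n); ring.
have h1 := double_pole n.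
have h2 m : 2 * (n%:R + a) + 1 + 1 != - m%:R.
  by have := h1 m.+1; rewrite -(natr1 m) opprD -subr_eq opprK.
have h3 m : n.+1%:R + a != - m%:R := nat_pole n.+1 m.
have g3 := Gamma_neq0 h3; have n3 := natDa_neq0 n.+1.
rewrite (GammaD1 h2) (GammaD1 h1) (natDaS n) (GammaD1 h3).
have e : 2 * (n%:R + a) + 1 + 1 = 2 * (n.+1%:R + a).
  by rewrite -(natr1 n); ring.
rewrite e; move: (n.+1%:R + a) g3 n3 => y g3 n3.
by field; rewrite g3 n3.
Qed.

(** Turns the inverse binomial into [hcoef]: by [cbS] and [hcoefS] the right side, like the left,
    gains a factor 4 when n increases by 1. *)
Lemma cb_hcoef n : a * cb 0 * 4 ^+ n = hcoef a n * (n%:R + a) * cb n.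
Proof.
move: cbS; generalize cb => c cS.
elim: n => [|n IH]; first by rewrite hcoef0 add0r; ring.
rewrite exprSr mulrA IH [RHS](_ : _ = hcoef a n.+1 * (c n.+1 * (n.+1%:R + a))).
  rewrite cS [RHS](_ : _ = 4 * c n * (hcoef a n.+1 * (n%:R + a + 2^-1))).
    by rewrite hcoefS//; ring.
  by field.
by ring.
Qed.

(** The exponent 2 (n + a) splits into the integer 2n and the constant 2a. The power 1 - k leaves (2
    (n + a))^k over 2 (n + a), and [cb_hcoef] absorbs this denominator. *)
Lemma PhiHCB_term k n (z : R[i]) : z != 0 ->
  2 ^ (k%:Z - 1) * (cpow (2 * z) (2 * (n%:R + a%:C)) /
    ((rbinom (2 * (n%:R + a)) (n%:R + a))%:C * cpow (n%:R + a%:C) (1 - k%:R))) =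
  cpow 4 a%:C * cpow z (2 * a%:C) / (2 * a%:C * (rbinom (2 * a) a)%:C) *
  (((2 * (n%:R + a)) ^+ k * hcoef a n)%:C * (z ^+ 2) ^+ n).
Proof.
move=> z0.
have na := natDaC_neq0 n.
have two : (2 : R[i]) = (2 : R)%:C by rewrite rmorph_nat.
have four : (4 : R[i]) = (2 : R)%:C * (2 : R)%:C by rewrite -!two -natrM.
have two0 : (2 : R)%:C != 0 by rewrite -two pnatr_eq0.
rewrite cpow_1subn// -/(cb n).
have -> : rbinom (2 * a) a = cb 0 by rewrite /cb add0r.
have -> : 2 * (n%:R + a%:C) = (2 * n)%:R + 2 * a%:C :> R[i].
  by rewrite natrM mulrDr.
rewrite cpowDn ?mulf_neq0 ?pnatr_eq0// [in cpow (2 * z)]two cpow_real_mul//.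
have -> : cpow 4 a%:C = cpow (2 : R)%:C (2 * a%:C) :> R[i].
  rewrite four cpow_real_mul// /cpow (negbTE two0) -cexpD.
  by congr cexp; ring.
have -> : (2 * z) ^+ (2 * n) = 4 ^+ n * (z ^+ 2) ^+ n.
  by rewrite exprMn !exprM (_ : 2 ^+ 2 = 4 :> R[i])// -natrX.
have h := congr1 (real_complex R) (cb_hcoef n).
have a0 : a%:C != 0.
  by rewrite fmorph_eq0; have := natDa_neq0 0; rewrite add0r.
have cb0 : (cb 0)%:C != 0 by rewrite fmorph_eq0 cb_neq0.
have cbn : (cb n)%:C != 0 by rewrite fmorph_eq0 cb_neq0.
have -> : 2 ^ (k%:Z - 1) = 2 ^+ k / 2 :> R[i].
  by rewrite expfzDr ?pnatr_eq0.
have ey : (n%:R + a)%:C = n%:R + a%:C :> R[i] by rewrite rmorphD rmorph_nat.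
move: (cb n) (cb 0%N) (hcoef a n) cbn cb0 h => c c0 u cn cn0 h.
rewrite !rmorphM !rmorphXn !rmorphM /= ey -two ?rmorph_nat in h *.
move: (n%:R + a%:C) (4 ^+ n) na h => y q y0 h.
have {h} -> : q = u%:C * y * c%:C / (a%:C * c0%:C).
  by rewrite -h mulrC mulKf ?mulf_neq0.
rewrite [(2 * y) ^+ k]exprMn.
by field; rewrite ?expf_neq0 ?y0 ?cn ?cn0 ?a0.
Qed.
End HCBTerm.

(** * Values of [hyp2F1] and [PhiHCB], and the final formula *)

Section MainLimits.
Local Open Scope classical_set_scope.
Variables (R : realType) (a : R).
Hypothesis ha : forall m : nat, a <> - (m%:R / 2).

Lemma poch_real (y : R) n : poch y%:C n = (poch y n)%:C.
Proof.
rewrite /poch rmorph_prod; apply: eq_bigr => i _.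
by rewrite rmorphD rmorph_nat.
Qed.

Lemma series_scale (c : R[i]) (f : nat -> R[i]) N :
  series (fun n => c * f n) N = c * series f N.
Proof. by rewrite /series /= mulr_sumr. Qed.

(* Euler's transformation of 2F1(1/2, a - 1/2; a + 1/2; x), with the principal
   branch of the square root. *)
Lemma hyp2F1_Euler (x lF : R[i]) : `|x| < 1 ->
  series (fun n => (hcoef a n)%:C * x ^+ n) @ \oo --> lF ->
  hyp2F1 2^-1 (a%:C - 2^-1) (a%:C + 2^-1) x = cpow (1 - x) 2^-1 * lF.
Proof.
move=> x1 hF; have [K hK] := hcoef_bounded ha.
have /cvg_ex[/= lA hA] := is_cvg_bounded_pseries (@sqrtcoef_bounded R) x1.
have x0 : 1 - x != 0.
  by apply: contraTneq x1 => /subr0_eq <-; rewrite normr1 ltxx.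
rewrite (cpow_halfE x0 (sqr_sqrt_series x1 hA) (Re_sqrt_series_gt0 x1 hA)).
apply: cvg_lim; first exact: norm_hausdorff.
apply: eq_cvgc (cvg_Cauchy_prod (@sqrtcoef_bounded R) hK x1 hA hF) => N.
congr (series _ N); apply/funext => n; congr (_ * _); rewrite Euler_coef//.
have e2 : 2^-1 = (2^-1 : R)%:C by rewrite fmorphV rmorph_nat.
rewrite fmorph_div !rmorphM /= e2 -rmorphB -rmorphD !poch_real.
by rewrite rmorph_nat.
Qed.

(** By [PhiHCB_term] the partial sums of [PhiHCB] are proportional to those of the series in [hS],
    and so converge with them. *)
Lemma PhiHCB_lim k (z lS : R[i]) : z != 0 ->
  series (fun n => ((2 * (n%:R + a)) ^+ k * hcoef a n)%:C * (z ^+ 2) ^+ n)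
    @ \oo --> lS ->
  2 ^ (k%:Z - 1) * PhiHCB (1 - k%:R) a z =
  cpow 4 a%:C * cpow z (2 * a%:C) / (2 * a%:C * (rbinom (2 * a) a)%:C) * lS.
Proof.
move=> z0 hS; set D := _ / _; set c := 2 ^ _.
have c0 : c != 0 by rewrite /c expfz_neq0// pnatr_eq0.
suff -> : PhiHCB (1 - k%:R) a z = c^-1 * D * lS by rewrite !mulrA mulfV// mul1r.
apply: cvg_lim; first exact: norm_hausdorff.
apply: eq_cvgc (cvgcM (cvgc_cst (c^-1 * D)) hS) => N.
rewrite -series_scale; congr (series _ N); apply/funext => n.
by apply: (mulfI c0); rewrite PhiHCB_term// !mulrA mulfV// mul1r.
Qed.

Lemma PhiHCB0 s : PhiHCB s a (0 : R[i]) = 0.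
Proof.
apply: cvg_lim; first exact: norm_hausdorff.
apply: eq_cvgc (cvgc_cst 0) => N; rewrite /series /= big1// => n _.
rewrite mulr0 /cpow eqxx mulf_eq0 pnatr_eq0 /=.
by rewrite (negbTE (natDaC_neq0 ha n)) mul0r.
Qed.
End MainLimits.

Theorem theorem3p3 (R : realType) (k : nat) (a : R) (z : R[i])
  (ha : forall m : nat, a <> - (m%:R / 2))
  (hz : `|z| < 1) :
  2 ^ (k%:Z - 1) * PhiHCB (1 - k%:R) a z =
  cpow 4 a%:C * cpow z (2 * a%:C) /
    (2 * a%:C * (rbinom (2 * a) a)%:C * cpow (1 - z ^+ 2) (k%:R + 2^-1)) *
  ((2 * a%:C - 1) * cpow (1 - z ^+ 2) 2^-1 * ceval (HCBp a k) (z ^+ 2)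
   + hyp2F1 2^-1 (a%:C - 2^-1) (a%:C + 2^-1) (z ^+ 2)
     * ceval (HCBq R k) (z ^+ 2)).
Proof.
(* At z = 0 both sides vanish: [cpow] sends 0^w to 0 for w != 0, and neither 2a nor any 2 (n + a) is
   zero. *)
have [->|z0] := eqVneq z 0.
  have a0 : a%:C != 0 by have := natDaC_neq0 ha 0; rewrite add0r.
  have -> : cpow 0 (2 * a%:C) = 0 :> R[i].
    by rewrite /cpow eqxx mulf_eq0 pnatr_eq0 (negbTE a0).
  by rewrite PhiHCB0// !(mulr0, mul0r).
have x1 : `|z ^+ 2| < 1 by rewrite normrX exprn_ilt1.
have x0 : 1 - z ^+ 2 != 0.
  by apply: contraTneq x1 => /subr0_eq <-; rewrite normr1 ltxx.
have [K hK] := hcoef_bounded ha.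
have /cvg_ex[/= lF hF] := is_cvg_bounded_pseries hK x1.
rewrite (PhiHCB_lim ha z0 (cvg_hpoly (k := k) ha x1 hF)) (hyp2F1_Euler ha x1 hF) cpowDn//.
have s0 : cpow (1 - z ^+ 2) 2^-1 != 0.
  by apply: (contraNneq _ x0) => s0; rewrite -(sqr_sqrtc x0) s0 expr0n.
rewrite !invfM.
move: (cpow (1 - _) _) s0 => s s0; rewrite [in LHS](mulrC _ lF).
(* The half power in the denominator cancels the square root common to both summands: explicit in
   the first, supplied by [hyp2F1_Euler] in the second. *)
transitivity (cpow 4 a%:C * cpow z (2 * a%:C) * (2^-1 / a%:C / (rbinom (2 * a) a)%:C)
  * (((1 - z ^+ 2) ^+ k)^-1 * (s^-1 * s))
  * ((2 * a%:C - 1) * ceval (HCBp a k) (z ^+ 2) + lF * ceval (HCBq R k) (z ^+ 2))).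
  by rewrite mulVf//; ring.
by ring.
Qed.
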